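(* Let $\mathcal K$ be a simplicial complex on the vertex set $[m]=\{1,\dots,m\}$ (without ghost vertices) such that any two missing faces of $\mathcal K$ have a common vertex. Then there is a homotopy equivalence $$U(\mathcal K)\simeq \Sigma^2 D(\mathcal K).$$ In the case of real arrangement complements there is a homotopy equivalence $$U_{\mathbb R}(\mathcal K)\simeq \Sigma D_{\mathbb R}(\mathcal K).$$
   Context: A simplicial complex $\mathcal K$ on $[m]$ is a collection of subsets of $[m]$ containing $\varnothing$ and closed under taking subsets; ''without ghost vertices'' means every $\{i\}$, $i\in[m]$, belongs to $\mathcal K$. A missing face of $\mathcal K$ is a subset $I\subset[m]$ with $I\notin\mathcal K$ but every proper subset of $I$ in $\mathcal K$. For $I=\{i_1,\dots,i_k\}\subset[m]$ let $C_I=\{z\in\mathbb C^m: z_{i_1}=\dots=z_{i_k}=0\}$ (coordinate subspace) and $D_I=\{z\in\mathbb C^m: z_{i_1}=\dots=z_{i_k}\}$ (diagonal subspace). The coordinate arrangement complement is $U(\mathcal K)=\mathbb C^m\setminus\bigcup_{I\notin\mathcal K}C_I$, and the diagonal arrangement complement is $D(\mathcal K)=\mathbb C^m\setminus\bigcup_{I\notin\mathcal K}D_I$. $U_{\mathbb R}(\mathcal K)$ and $D_{\mathbb R}(\mathcal K)$ are defined in the same way with $\mathbb R^m$ in place of $\mathbb C^m$. $\Sigma$ denotes suspension. *)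

(* Defs.v *)
From HB Require Import structures.
From mathcomp Require Import all_boot all_order all_algebra generic_quotient.
From mathcomp Require Import all_classical all_reals all_analysis.
Set Implicit Arguments. Unset Strict Implicit. Unset Printing Implicit Defensive.
Import Order.TTheory GRing.Theory Num.Theory.
Import numFieldNormedType.Exports.

Definition is_simplicial_complex (m : nat) (K : {set {set 'I_m}}) : Prop :=
  (finset.set0 : {set 'I_m}) \in K /\ (forall I J : {set 'I_m}, I \in K -> J \subset I -> J \in K).

Definition no_ghost_vertices (m : nat) (K : {set {set 'I_m}}) : Prop :=
  forall i : 'I_m, [set i] \in K.

Definition missing_face (m : nat) (K : {set {set 'I_m}}) (I : {set 'I_m}) : Prop :=
  I \notin K /\ (forall J : {set 'I_m}, J \proper I -> J \in K).

Local Open Scope classical_set_scope.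
Local Open Scope ring_scope.
Local Open Scope quotient_scope.

Notation unit_interval R := (set_type (`[0, 1]%classic : set R)).

Definition homotopic (R : realType) (X Y : topologicalType) (f g : X -> Y) : Prop :=
  exists H : (X * unit_interval R)%type -> Y,
    continuous H /\
    (forall (x : X) (t : unit_interval R), set_val t = 0 -> H (x, t) = f x) /\
    (forall (x : X) (t : unit_interval R), set_val t = 1 -> H (x, t) = g x).

Definition homotopy_equivalent (R : realType) (X Y : topologicalType) : Prop :=
  exists (f : X -> Y) (g : Y -> X),
    continuous f /\ continuous g /\
    homotopic R (g \o f) idfun /\ homotopic R (f \o g) idfun.

Section Suspension.
Context (R : realType) (X : topologicalType).

Definition susp_rel' (a b : (X * unit_interval R)%type) : bool :=
  [|| a == b,
      (set_val a.2 == 0) && (set_val b.2 == 0) |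
      (set_val a.2 == 1) && (set_val b.2 == 1)].

Lemma susp_rel_refl : reflexive susp_rel'.
Proof. by move=> a; rewrite /susp_rel' eqxx. Qed.

Lemma susp_rel_sym : symmetric susp_rel'.
Proof.
move=> a b; rewrite /susp_rel' (eq_sym a b).
by rewrite (andbC (set_val a.2 == 0)) (andbC (set_val a.2 == 1)).
Qed.

Lemma susp_rel_trans : transitive susp_rel'.
Proof.
move=> b a c; rewrite /susp_rel'.
case/or3P=> [/eqP -> //| /andP[/eqP a0 /eqP b0] | /andP[/eqP a1 /eqP b1]];
  case/or3P=> [/eqP <- | /andP[/eqP b0' /eqP c0] | /andP[/eqP b1' /eqP c1]].
- by rewrite a0 b0 eqxx orbT.
- by rewrite a0 c0 eqxx orbT.
- by move: b0; rewrite b1' => /eqP; rewrite oner_eq0.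
- by rewrite a1 b1 !eqxx !orbT.
- by move: b1; rewrite b0' => /eqP; rewrite eq_sym oner_eq0.
- by rewrite a1 c1 !eqxx !orbT.
Qed.

Definition susp_rel := EquivRel _ susp_rel_refl susp_rel_sym susp_rel_trans.

Definition suspension := {eq_quot susp_rel}.
HB.instance Definition _ := Topological.copy suspension (quotient_topology suspension).
HB.instance Definition _ := Quotient.on suspension.
End Suspension.

(** ** Arrangement complements.  The field is F (R for real, R*R = C for
    complex), with product topology on F^m = {ptws 'I_m -> F}. *)
Section Arrangements.
Context (F : topologicalType) (z0 : F) (m : nat) (K : {set {set 'I_m}}).

Definition coord_compl : set {ptws 'I_m -> F} :=
  [set z | forall I : {set 'I_m}, I \notin K -> exists i, i \in I /\ z i <> z0].

Definition diag_compl : set {ptws 'I_m -> F} :=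
  [set z | forall I : {set 'I_m}, I \notin K ->
           exists i j, [/\ i \in I, j \in I & z i <> z j]].
End Arrangements.

(* complex numbers C are modelled as R * R with the product topology *)

Notation U_C R K :=
  (set_type (coord_compl ((0 : R), (0 : R)) K)).
Notation D_C R K :=
  (set_type (@diag_compl (R * R)%type _ K)).
Notation U_R R K :=
  (set_type (coord_compl (0 : R) K)).
Notation D_R R K :=
  (set_type (@diag_compl R _ K)).

(* Main.v *)
Require Import Defs.
From HB Require Import structures.
From mathcomp Require Import all_boot all_order all_algebra generic_quotient.
From mathcomp Require Import all_classical all_reals all_analysis.
From mathcomp Require Import lra.
Import numFieldNormedType.Exports.
Set Implicit Arguments. Unset Strict Implicit. Unset Printing Implicit Defensive.
Import Order.TTheory GRing.Theory Num.Theory.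
Local Open Scope classical_set_scope.
Local Open Scope ring_scope.
Local Open Scope quotient_scope.

(** Let F be R or C.  Since nonfaces meet pairwise, s(x), the maximum over the
    nonfaces I of min_{i in I} x_i (applied to real and imaginary parts
    separately when F = C), is a continuous function taking the value c at every
    x that is constantly c on some nonface.  Hence U(K) consists of the x that
    lie in D(K) or satisfy s(x) <> 0, and x |-> (x, s(x)) identifies it up to
    homotopy with the pairs (v, c) in F^m x F such that v is in D(K) or c <> 0.
    For a contractible V and an open D in V that is the positivity set of a
    continuous function phi, the pairs (v, c) in V x R with v in D or c <> 0 form
    a space homotopy equivalent to the suspension of D: where |c| >= phi(v) / 2
    the suspension coordinate is constant, so that the map is locally constant
    near the points with v outside D and hence continuous for the quotient
    topology at the poles.  The complex case applies this twice. *)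

(** * Continuity for products, subspaces and real-valued maps *)

Lemma continuous_compose (X Y Z : topologicalType) (f : X -> Y) (g : Y -> Z) :
  continuous f -> continuous g -> continuous (fun x => g (f x)).
Proof. by move=> cf cg x; apply: continuous_comp; [exact: cf|exact: cg]. Qed.

Lemma continuous_pairing (X Y Z : topologicalType) (f : X -> Y) (g : X -> Z) :
  continuous f -> continuous g -> continuous (fun x => (f x, g x)).
Proof. by move=> cf cg x; apply: cvg_pair; [exact: cf|exact: cg]. Qed.

Lemma continuous_fst (X Y : topologicalType) : continuous (@fst X Y).
Proof. by move=> x; exact: cvg_fst. Qed.

Lemma continuous_snd (X Y : topologicalType) : continuous (@snd X Y).
Proof. by move=> x; exact: cvg_snd. Qed.

Lemma continuous_set_val (X : topologicalType) (A : set X) :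
  continuous (set_val : set_type A -> X).
Proof. exact: initial_continuous. Qed.

Lemma cvg_set_type (X T : topologicalType) (A : set X) (F : set_system T)
    (f : T -> set_type A) (a : set_type A) {FF : Filter F} :
  set_val (f x) @[x --> F] --> set_val a -> f x @[x --> F] --> a.
Proof.
move=> fa U [_ [[W oW <-] Wa] WU].
have /fa : nbhs (set_val a) W by exact: open_nbhs_nbhs.
by apply: (@filterS _ F FF) => x; exact: WU.
Qed.

Lemma continuous_set_type (X T : topologicalType) (A : set X)
    (f : T -> set_type A) :
  continuous (fun x => set_val (f x)) -> continuous f.
Proof. by move=> cf x; exact: cvg_set_type (cf x). Qed.

Lemma set_val_mem (X : Type) (A : set X) (a : set_type A) : A (set_val a).
Proof. exact: set_valP. Qed.

Lemma set_val_injective (X : choiceType) (A : set X) :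
  injective (set_val : set_type A -> X).
Proof. exact: val_inj. Qed.

Section RealValued.
Context (R : realType) (T : topologicalType) (f g : T -> R).
Hypotheses (cf : continuous f) (cg : continuous g).

Lemma continuous_maxr : continuous (fun x => Num.max (f x) (g x)).
Proof. by move=> x; exact: (@continuous_max R T f g x (@cf x) (@cg x)). Qed.

Lemma continuous_minr : continuous (fun x => Num.min (f x) (g x)).
Proof. by move=> x; exact: (@continuous_min R T f g x (@cf x) (@cg x)). Qed.

Lemma continuous_addr : continuous (fun x => f x + g x).
Proof. by move=> x; exact: (cvgD (@cf x) (@cg x)). Qed.

Lemma continuous_subr : continuous (fun x => f x - g x).
Proof. by move=> x; exact: (cvgB (@cf x) (@cg x)). Qed.

Lemma continuous_mulr : continuous (fun x => f x * g x).
Proof. by move=> x; exact: (cvgM (@cf x) (@cg x)). Qed.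

Lemma continuous_normr : continuous (fun x => `|f x|).
Proof. by move=> x; exact: (cvg_norm (@cf x)). Qed.

Lemma continuous_divr : (forall x, g x != 0) -> continuous (fun x => f x / g x).
Proof. by move=> g0 x; exact: (cvgM (@cf x) (cvgV (g0 x) (@cg x))). Qed.

End RealValued.

(** * The unit interval and its product with a quotient map *)

Section UnitInterval.
Context (R : realType).
Local Notation I := (unit_interval R).

Lemma clamp_subproof (t : R) : Num.max 0 (Num.min 1 t) \in (`[0, 1]%classic : set R).
Proof.
by rewrite inE /= in_itv /= le_max lexx ge_max ler01 ge_min lexx.
Qed.

(** A retraction of [R] onto the unit interval, so that times can be computed in [R] with no bound
    to prove beforehand. *)
Definition clamp (t : R) : I := SigSub (clamp_subproof t).

Lemma clampE (t : R) : set_val (clamp t) = Num.max 0 (Num.min 1 t).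
Proof. by []. Qed.

Lemma unit_interval_ge0 (t : I) : 0 <= set_val t.
Proof. by have := set_val_mem t; rewrite /= in_itv /= => /andP[]. Qed.

Lemma unit_interval_le1 (t : I) : set_val t <= 1.
Proof. by have := set_val_mem t; rewrite /= in_itv /= => /andP[]. Qed.

Lemma clampK (t : R) : 0 <= t <= 1 -> set_val (clamp t) = t.
Proof. by move=> /andP[t0 t1]; rewrite clampE min_r// max_r. Qed.

Lemma set_valK (t : I) : clamp (set_val t) = t.
Proof.
by apply: set_val_injective; rewrite clampK// unit_interval_ge0 unit_interval_le1.
Qed.

Lemma continuous_clamp : continuous clamp.
Proof.
apply: continuous_set_type; apply: continuous_maxr; first exact: cst_continuous.
by apply: continuous_minr; [exact: cst_continuous|move=> ?; exact: cvg_id].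
Qed.

(* Curry, use the universal property of the quotient, and uncurry, which is
   allowed because R is locally compact. *)
Lemma quotient_prod_continuous (T : topologicalType) (Q0 : quotType T)
    (Y : topologicalType) (H : quotient_topology Q0 * I -> Y) :
  continuous (fun p : T * I => H (\pi_(quotient_topology Q0) p.1, p.2)) ->
  continuous H.
Proof.
move=> cH.
pose G (q : quotient_topology Q0) (t : R) : Y := H (q, clamp t).
have cG0 : continuous (fun p : T * R => G (\pi_(quotient_topology Q0) p.1) p.2).
  apply: (@continuous_compose _ (T * I)%type _
    (fun p : T * R => (p.1, clamp p.2)) _ _ cH).
  apply: continuous_pairing; first exact: continuous_fst.
  apply: continuous_compose; [exact: continuous_snd|exact: continuous_clamp].
have cG : continuous (uncurry G).
  apply: continuous_uncurry_regular.
  - exact: locally_compactR.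
  - exact: uniform_regular.
  - apply: (quotient_continuous (Z := {compact-open, R -> Y}) G).2.
    exact: (continuous_curry cG0).1.
  - move=> q; rewrite -[q]reprK; exact: (continuous_curry cG0).2.
have -> : H = fun p => uncurry G (p.1, set_val p.2).
  by apply/funext => -[q t]; rewrite /= /G set_valK.
apply: continuous_compose cG; apply: continuous_pairing.
  exact: continuous_fst.
exact: continuous_compose (@continuous_snd _ _) (@continuous_set_val _ _).
Qed.

(** * Calculus of homotopies *)

Section Homotopy.
Context {X Y Z : topologicalType}.

Lemma homotopic_trans (f g h : X -> Y) :
  homotopic R f g -> homotopic R g h -> homotopic R f h.
Proof.
move=> [H [cH [H0 H1]]] [G [cG [G0 G1]]].
pose L (p : X * I) := H (p.1, clamp (2 * set_val p.2)).
pose M (p : X * I) := G (p.1, clamp (2 * set_val p.2 - 1)).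
pose E (p : X * I) := if set_val p.2 <= 2^-1 then L p else M p.
have cv : continuous (fun p : X * I => set_val p.2).
  exact: continuous_compose (@continuous_snd _ _) (@continuous_set_val _ _).
have cL : continuous L.
  apply: continuous_compose cH; apply: continuous_pairing.
    exact: continuous_fst.
  apply: continuous_compose continuous_clamp.
  by apply: continuous_mulr; [exact: cst_continuous|exact: cv].
have cM : continuous M.
  apply: continuous_compose cG; apply: continuous_pairing.
    exact: continuous_fst.
  apply: continuous_compose continuous_clamp.
  apply: continuous_subr; last exact: cst_continuous.
  by apply: continuous_mulr; [exact: cst_continuous|exact: cv].
exists E; split; [|split].
(* Two closed halves cover the product; they meet at time [2^-1], where [L] and [M] both equal
   [g]. *)
- pose A := [set p : X * I | set_val p.2 <= 2^-1].
  pose B := [set p : X * I | 2^-1 <= set_val p.2].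
  have AB : A `|` B = setT.
    by apply/seteqP; split => // p _; rewrite /A /B /=; apply/orP; exact: le_total.
  apply/continuous_subspace_setT; rewrite -AB; apply: withinU_continuous.
  + apply: (closed_comp _ (@closed_le _ (2^-1))) => p _; exact: cv.
  + apply: (closed_comp _ (@closed_ge _ (2^-1))) => p _; exact: cv.
  + apply: (@subspace_eq_continuous _ _ _ L); last exact: continuous_subspaceT.
    by move=> p /set_mem pA; rewrite /from_subspace /E ifT.
  + apply: (@subspace_eq_continuous _ _ _ M); last exact: continuous_subspaceT.
    move=> p /set_mem p2; rewrite /from_subspace /E; case: ifPn => // p2'.
    have {p2'} pE : set_val p.2 = 2^-1 by apply/eqP; rewrite eq_le p2 p2'.
    rewrite /L /M pE mulfV ?pnatr_eq0// subrr.
    by rewrite G0 ?H1// clampK// ?lexx ler01.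
- by move=> x t t0; rewrite /E /= t0 invr_ge0 ler0n /L /= t0 mulr0 H0// clampK// lexx ler01.
- move=> x t t1.
  have -> : E (x, t) = M (x, t) by rewrite /E /= t1 ifF//; apply/negbTE; rewrite -ltNge; lra.
  rewrite /M /= t1 (_ : 2 * 1 - 1 = 1); last by lra.
  by rewrite G1// clampK ?lexx ?ler01.
Qed.

Lemma homotopic_comp_l (f g : X -> Y) (k : Y -> Z) : continuous k ->
  homotopic R f g -> homotopic R (k \o f) (k \o g).
Proof.
move=> ck [H [cH [H0 H1]]]; exists (k \o H); split; first exact: continuous_compose ck.
by split => x t tE /=; [rewrite H0|rewrite H1].
Qed.

Lemma homotopic_comp_r (f g : Y -> Z) (k : X -> Y) : continuous k ->
  homotopic R f g -> homotopic R (f \o k) (g \o k).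
Proof.
move=> ck [H [cH [H0 H1]]]; exists (fun p => H (k p.1, p.2)); split.
  apply: continuous_compose cH; apply: continuous_pairing.
    exact: continuous_compose (@continuous_fst _ _) ck.
  exact: continuous_snd.
by split => x t tE /=; [rewrite H0|rewrite H1].
Qed.

End Homotopy.

Lemma homotopy_equivalent_trans (X Y Z : topologicalType) :
  homotopy_equivalent R X Y -> homotopy_equivalent R Y Z ->
  homotopy_equivalent R X Z.
Proof.
move=> [f [g [cf [cg [gf fg]]]]] [f' [g' [cf' [cg' [gf' fg']]]]].
exists (f' \o f), (g \o g'); split; first exact: continuous_compose cf'.
split; first exact: continuous_compose cg.
split.
- apply: homotopic_trans gf.
  exact: (homotopic_comp_l cg (homotopic_comp_r cf gf')).
- apply: homotopic_trans fg'.
  exact: (homotopic_comp_l cf' (homotopic_comp_r cg' fg)).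
Qed.

(** Lets maps and homotopies be written on the ambient spaces with real time; what remains is that
    they preserve the subsets during the unit interval. *)
Lemma homotopy_equivalent_subsets (X Y : topologicalType) (A : set X) (B : set Y)
    (f : X -> Y) (g : Y -> X) (H : X * R -> X) (G : Y * R -> Y) :
  continuous f -> continuous g -> continuous H -> continuous G ->
  (forall x, A x -> B (f x)) -> (forall y, B y -> A (g y)) ->
  (forall x t, 0 <= t <= 1 -> A x -> A (H (x, t))) ->
  (forall y t, 0 <= t <= 1 -> B y -> B (G (y, t))) ->
  (forall x, H (x, 0) = g (f x)) -> (forall x, H (x, 1) = x) ->
  (forall y, G (y, 0) = f (g y)) -> (forall y, G (y, 1) = y) ->
  homotopy_equivalent R (set_type A) (set_type B).
Proof.
move=> cf cg cH cG AB BA HA GB H0 H1 G0 G1.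
pose f' (a : set_type A) : set_type B := SigSub (mem_set (AB _ (set_val_mem a))).
pose g' (b : set_type B) : set_type A := SigSub (mem_set (BA _ (set_val_mem b))).
have I01 (t : I) : 0 <= set_val t <= 1.
  by rewrite unit_interval_ge0 unit_interval_le1.
pose H' (p : set_type A * I) : set_type A :=
  SigSub (mem_set (HA _ _ (I01 p.2) (set_val_mem p.1))).
pose G' (p : set_type B * I) : set_type B :=
  SigSub (mem_set (GB _ _ (I01 p.2) (set_val_mem p.1))).
have cvv (T : topologicalType) (C : set T) :
    continuous (fun p : set_type C * I => (set_val p.1, set_val p.2)).
  apply: continuous_pairing.
    exact: continuous_compose (@continuous_fst _ _) (@continuous_set_val _ _).
  exact: continuous_compose (@continuous_snd _ _) (@continuous_set_val _ _).
exists f', g'; split.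
  by apply: continuous_set_type; exact: continuous_compose (@continuous_set_val _ _) cf.
split.
  by apply: continuous_set_type; exact: continuous_compose (@continuous_set_val _ _) cg.
split.
- exists H'; split; first by apply: continuous_set_type; exact: continuous_compose (cvv _ _) cH.
  by split => x t tE; apply: set_val_injective;
    rewrite -[LHS]/(H (set_val x, set_val t)) tE; [exact: H0|exact: H1].
- exists G'; split; first by apply: continuous_set_type; exact: continuous_compose (cvv _ _) cG.
  by split => x t tE; apply: set_val_injective;
    rewrite -[LHS]/(G (set_val x, set_val t)) tE; [exact: G0|exact: G1].
Qed.

(** * Maps out of a suspension, and its functoriality *)

Section SuspensionMaps.
Context {X : topologicalType}.
Local Notation SX := (suspension R X).

Lemma susp_eqP (a b : X * I) : set_val a.2 = set_val b.2 ->
  set_val a.2 = 0 \/ set_val a.2 = 1 -> \pi_SX a = \pi_SX b.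
Proof.
move=> ab a01; apply/eqmodP; rewrite /= /susp_rel' -!ab.
by case: a01 => ->; rewrite !eqxx ?orbT.
Qed.

Lemma continuous_susp_pi : continuous (\pi_SX : X * I -> SX).
Proof. exact: pi_continuous. Qed.

(** The class of [a] is a singleton unless [a] lies at an end, where a representative retains only
    the height. *)
Lemma repr_susp (a : X * I) : repr (\pi_SX a) = a \/
  (set_val (repr (\pi_SX a)).2 = set_val a.2 /\
    (set_val a.2 = 0 \/ set_val a.2 = 1)).
Proof.
have /eqmodP : \pi_SX (repr (\pi_SX a)) = \pi_SX a by rewrite reprK.
rewrite /= /susp_rel' => /or3P[/eqP|/andP[/eqP-> /eqP->]|/andP[/eqP-> /eqP->]].
- by left.
- by right; split => //; left.
- by right; split => //; right.
Qed.

(** Constancy on each end makes the value at [repr] independent of the representative. *)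
Lemma susp_lift (Y : topologicalType) (F : X * I -> Y) : continuous F ->
  (forall x x' t, set_val t = 0 \/ set_val t = 1 -> F (x, t) = F (x', t)) ->
  exists2 G : SX -> Y, continuous G & forall a, G (\pi_SX a) = F a.
Proof.
move=> cF FE.
have repE a : F (repr (\pi_SX a)) = F a.
  have [->//|[]] := repr_susp a.
  case: (repr _) => x t; case: a => x' t' /= /set_val_injective -> t01.
  exact: FE.
exists (fun q => F (repr q)) => //.
apply/quotient_continuous; rewrite (_ : _ \o _ = F)//.
by apply/funext => a; exact: repE.
Qed.

(** The same descent with a time parameter. Continuity rests on [quotient_prod_continuous], as a
    quotient map times a space is not a quotient map in general. *)
Lemma susp_lift_homotopy (Y : topologicalType) (F : X * I * I -> Y) :
  continuous F ->
  (forall x x' t r, set_val t = 0 \/ set_val t = 1 ->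
    F ((x, t), r) = F ((x', t), r)) ->
  exists2 G : SX * I -> Y, continuous G &
    forall a r, G (\pi_SX a, r) = F (a, r).
Proof.
move=> cF FE.
have repE a r : F (repr (\pi_SX a), r) = F (a, r).
  have [->//|[]] := repr_susp a.
  case: (repr _) => x t; case: a => x' t' /= /set_val_injective -> t01.
  exact: FE.
exists (fun p => F (repr p.1, p.2)) => //.
apply: quotient_prod_continuous.
rewrite (_ : (fun p => _) = F)//; apply/funext => -[a r]; exact: repE.
Qed.

End SuspensionMaps.

Lemma susp_ext (X : topologicalType) (Y : Type) (f g : suspension R X -> Y) :
  (forall a, f (\pi_(suspension R X) a) = g (\pi_(suspension R X) a)) -> f = g.
Proof. by move=> fg; apply/funext => q; rewrite -[q]reprK. Qed.

Definition susp_map (X Y : topologicalType) (f : X -> Y) (q : suspension R X) :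
  suspension R Y := \pi_(suspension R Y) (f (repr q).1, (repr q).2).

Lemma susp_mapE (X Y : topologicalType) (f : X -> Y) (a : X * I) :
  susp_map f (\pi_(suspension R X) a) = \pi_(suspension R Y) (f a.1, a.2).
Proof.
rewrite /susp_map; have [->//|[e t01]] := repr_susp a.
by apply: susp_eqP => /=; rewrite e.
Qed.

Lemma continuous_susp_map (X Y : topologicalType) (f : X -> Y) :
  continuous f -> continuous (susp_map f).
Proof.
move=> cf; have [||G cG GE] := @susp_lift X _ (fun a => \pi_(suspension R Y) (f a.1, a.2)).
- apply: continuous_compose (@continuous_susp_pi _); apply: continuous_pairing.
    exact: continuous_compose (@continuous_fst _ _) cf.
  exact: continuous_snd.
- by move=> x x' t t01; exact: susp_eqP.
- by rewrite (_ : susp_map f = G)//; apply: susp_ext => a; rewrite susp_mapE GE.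
Qed.

Lemma homotopic_susp_map (X Y : topologicalType) (f g : X -> Y) :
  homotopic R f g -> homotopic R (susp_map f) (susp_map g).
Proof.
move=> [H [cH [H0 H1]]].
have [||G cG GE] := @susp_lift_homotopy X _
    (fun p => \pi_(suspension R Y) (H (p.1.1, p.2), p.1.2)).
- apply: continuous_compose (@continuous_susp_pi _); apply: continuous_pairing.
    apply: continuous_compose cH; apply: continuous_pairing; last exact: continuous_snd.
    exact: continuous_compose (@continuous_fst _ _) (@continuous_fst _ _).
  exact: continuous_compose (@continuous_fst _ _) (@continuous_snd _ _).
- by move=> x x' t r t01; exact: susp_eqP.
by exists G; split=> //; split => q t tE; rewrite -[q]reprK GE susp_mapE;
  [rewrite H0|rewrite H1].
Qed.

(** Suspension is a functor that preserves homotopies, so it carries homotopy inverses to homotopy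
    inverses. *)
Lemma homotopy_equivalent_susp (X Y : topologicalType) :
  homotopy_equivalent R X Y ->
  homotopy_equivalent R (suspension R X) (suspension R Y).
Proof.
move=> [f [g [cf [cg [gf fg]]]]].
exists (susp_map f), (susp_map g).
split; first exact: continuous_susp_map.
split; first exact: continuous_susp_map.
have idE (Z : topologicalType) : susp_map idfun = idfun :> (suspension R Z -> _).
  by apply: susp_ext => -[x t]; exact: susp_mapE.
have compE (Z W T : topologicalType) (k : Z -> W) (l : W -> T) :
    susp_map l \o susp_map k = susp_map (l \o k).
  apply: susp_ext => a; rewrite -[LHS]/(susp_map l (susp_map k _)).
  by rewrite !susp_mapE.
by rewrite !compE -!idE; split; exact: homotopic_susp_map.
Qed.

End UnitInterval.

(** * Removing from V x R the points of height 0 outside an open set gives its suspension *)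

Definition thickening (R : realType) (V : topologicalType) (phi : V -> R) :
  set (V * R)%type := [set w | 0 < phi w.1 \/ w.2 <> 0].

Section ThickeningSuspension.
Context (R : realType) (V : topologicalType) (phi : V -> R).
(** [h] contracts [V] to [p0], and [v0] is a point of the open set, used as a default value. *)
Context (h : V * R -> V) (p0 : V) (v0 : V).
Hypothesis continuous_phi : continuous phi.
Hypothesis phi_ge0 : forall v, 0 <= phi v.
Hypothesis phi_le1 : forall v, phi v <= 1.
Hypothesis phi_v0 : 0 < phi v0.
Hypothesis continuous_h : continuous h.
Hypothesis h0 : forall v, h (v, 0) = v.
Hypothesis h1 : forall v, h (v, 1) = p0.

Local Notation I := (unit_interval R).
Let D : set V := [set v | 0 < phi v].
Let W : set (V * R)%type := thickening phi.
Local Notation SD := (suspension R (set_type D)).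

Let den (w : V * R) : R := Num.max (phi w.1) (2 * `|w.2|).

(* The height [w.2 / (phi w.1 / 2)] truncated to [-1, 1], written so that it is
   visibly continuous on the thickening. *)
Let u (w : V * R) : R := 2 * w.2 / den w.

Let den_ge w : 2 * `|w.2| <= den w.
Proof. by rewrite le_max lexx orbT. Qed.

Let den_gt0 w : W w -> 0 < den w.
Proof.
rewrite lt_max => -[->//|/eqP w2]; apply/orP; right.
by rewrite mulr_gt0// normr_gt0.
Qed.

Let u_bound w : W w -> -1 <= u w <= 1.
Proof.
move=> /den_gt0 d0; have := den_ge w.
have := ler_norm w.2; have := ler_norm (- w.2); rewrite normrN => a b c.
by rewrite /u ler_pdivrMr// ler_pdivlMr//; apply/andP; split; lra.
Qed.

Let u_eq0 w : W w -> u w = 0 -> w.2 = 0.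
Proof.
move=> /den_gt0 d0 /eqP; rewrite /u !mulf_eq0 invr_eq0 pnatr_eq0/=.
by rewrite (gt_eqF d0) orbF => /eqP.
Qed.

Let u_ge0 w : W w -> (0 <= u w) = (0 <= w.2).
Proof. by move=> /den_gt0 d0; rewrite /u pmulr_lge0 ?invr_gt0// pmulr_rge0. Qed.

Let u_eq1 w : W w -> 0 <= w.2 -> phi w.1 <= 2 * w.2 -> u w = 1.
Proof.
move=> /den_gt0 d0 w2 pw; rewrite /u; have -> : den w = 2 * w.2.
  by rewrite /den ger0_norm// max_r.
rewrite divff//; apply: lt0r_neq0; move: d0; rewrite /den ger0_norm// max_r//.
Qed.

Let u_eqN1 w : W w -> w.2 <= 0 -> phi w.1 <= - (2 * w.2) -> u w = -1.
Proof.
move=> /den_gt0 d0 w2 pw; have dE : den w = - (2 * w.2).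
  by rewrite /den ler0_norm// mulrN max_r.
by rewrite /u -[2 * w.2]opprK -dE mulNr divff// lt0r_neq0.
Qed.

Let continuous_u : continuous (fun w : set_type W => u (set_val w)).
Proof.
have c2 : continuous (fun w : set_type W => (set_val w).2).
  exact: continuous_compose (@continuous_set_val _ _) (@continuous_snd _ _).
have c1 : continuous (fun w : set_type W => phi (set_val w).1).
  apply: continuous_compose continuous_phi.
  exact: continuous_compose (@continuous_set_val _ _) (@continuous_fst _ _).
apply: continuous_divr.
- by apply: continuous_mulr; first exact: cst_continuous.
- apply: continuous_maxr => //; apply: continuous_mulr; first exact: cst_continuous.
  exact: continuous_normr.
- by move=> w; rewrite lt0r_neq0// den_gt0//; exact: set_val_mem.
Qed.

Let d0 : set_type D := SigSub (mem_set (phi_v0 : D v0)).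

(** The default outside [D] is harmless: [phi] vanishes there, which puts the height of a point of
    [W] at a pole. *)
Let toD (v : V) : set_type D := insubd d0 v.

Let toDE v : D v -> set_val (toD v) = v.
Proof. by move=> Dv; rewrite /toD set_valE insubdK//; exact: mem_set. Qed.

Let toDK (d : set_type D) : toD (set_val d) = d.
Proof. by apply: set_val_injective; rewrite toDE//; exact: set_val_mem. Qed.

Let open_D : open D.
Proof.
rewrite (_ : D = phi @^-1` [set t | 0 < t])//.
by apply: open_comp => [v _|]; [exact: continuous_phi|exact: open_gt].
Qed.

Let continuous_toD v : D v -> {for v, continuous toD}.
Proof.
move=> Dv; apply: cvg_set_type; rewrite toDE//.
have : v @[v --> v] --> v by exact: cvg_id.
apply: cvg_trans; apply: near_eq_cvg.
have : nbhs v D by exact: open_nbhs_nbhs.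
by apply: filterS => x /toDE ->.
Qed.

Let to_susp (w : set_type W) : SD :=
  \pi_SD (toD (set_val w).1, clamp ((1 + u (set_val w)) / 2)).

Let to_susp_top w : 0 <= (set_val w).2 ->
  phi (set_val w).1 <= 2 * (set_val w).2 -> to_susp w = \pi_SD (d0, clamp 1).
Proof.
move=> w2 pw; apply: susp_eqP; rewrite /= u_eq1//;
  [|exact: set_val_mem|right|exact: set_val_mem].
  by rewrite divff// pnatr_eq0.
by rewrite divff ?pnatr_eq0// clampK// ler01 lexx.
Qed.

Let to_susp_bot w : (set_val w).2 <= 0 ->
  phi (set_val w).1 <= - (2 * (set_val w).2) -> to_susp w = \pi_SD (d0, clamp 0).
Proof.
move=> w2 pw; apply: susp_eqP; rewrite /= u_eqN1//;
  [|exact: set_val_mem|left|exact: set_val_mem].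
  by rewrite subrr mul0r.
by rewrite subrr mul0r clampK// ler01 lexx.
Qed.

(** Over [D] this is a composite of continuous maps. Elsewhere [phi] is 0 and the second coordinate
    is not, so [phi] stays below twice its absolute value nearby, where the map is constantly a
    pole. *)
Let continuous_to_susp : continuous to_susp.
Proof.
have c2 : continuous (fun w : set_type W => (set_val w).2).
  exact: continuous_compose (@continuous_set_val _ _) (@continuous_snd _ _).
have c1 : continuous (fun w : set_type W => (set_val w).1).
  exact: continuous_compose (@continuous_set_val _ _) (@continuous_fst _ _).
have locally_const (a : set_type W -> R) (w : set_type W) (q : SD) :
    continuous a -> 0 < a w -> (forall x, 0 < a x -> to_susp x = q) ->
    to_susp x @[x --> w] --> to_susp w.
  move=> ca aw aq U; rewrite (aq _ aw) => /nbhs_singleton Uq.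
  have : nbhs w (a @^-1` [set t | 0 < t]).
    apply: open_nbhs_nbhs; split => //; apply: open_comp; last exact: open_gt.
    by move=> x _; exact: ca.
  by apply: filterS => x /= /aq ->.
move=> w; case: (ltP 0 (phi (set_val w).1)) => [Dw|].
  have ct : toD (set_val x).1 @[x --> w] --> toD (set_val w).1.
    exact: (continuous_comp (c1 w) (continuous_toD Dw)).
  have cc : continuous (fun w : set_type W => clamp ((1 + u (set_val w)) / 2)).
    apply: continuous_compose (@continuous_clamp R).
    apply: continuous_mulr; last exact: cst_continuous.
    by apply: continuous_addr; first exact: cst_continuous.
  have cp : {for w, continuous (fun w : set_type W =>
      (toD (set_val w).1, clamp ((1 + u (set_val w)) / 2)))}.
    exact: cvg_pair ct (cc w).
  exact: (continuous_comp cp (@continuous_susp_pi R (set_type D) _)).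
move=> phi_le0; have phi0 : phi (set_val w).1 = 0.
  by apply/eqP; rewrite eq_le phi_le0 phi_ge0.
have [||w2] := ltgtP (set_val w).2 0.
- move=> w2.
  (* Since [phi] is nonnegative, positivity of this function also forces a negative second
     coordinate. *)
  apply: (locally_const (fun x => - 2 * (set_val x).2 - phi (set_val x).1)).
  + apply: continuous_subr; last exact: continuous_compose c1 continuous_phi.
    by apply: continuous_mulr; first exact: cst_continuous.
  + by rewrite phi0; lra.
  + by move=> x px; apply: to_susp_bot; have := phi_ge0 (set_val x).1; lra.
- move=> w2.
  apply: (locally_const (fun x => 2 * (set_val x).2 - phi (set_val x).1)).
  + apply: continuous_subr; last exact: continuous_compose c1 continuous_phi.
    by apply: continuous_mulr; first exact: cst_continuous.
  + by rewrite phi0; lra.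
  + by move=> x px; apply: to_susp_top; have := phi_ge0 (set_val x).1; lra.
- by have := set_val_mem w; rewrite /W /thickening /= phi0 ltxx w2 => -[].
Qed.

Let half_bound (x : R) : -1 <= x <= 1 -> 0 <= (1 + x) / 2 <= 1.
Proof. move=> /andP[a b]; apply/andP; split; lra. Qed.

(** The factor [s] scales the contraction time: [s = 1] collapses each end to a point and yields the
    inverse map, [s = 0] leaves [d] in place. At the middle height the time is 0 for every [s], so
    the point stays in [D]. *)
Let lift_subproof (d : set_type D) (t : R) (s : R) :
  W (h (set_val d, s * `|2 * t - 1|), 2 * t - 1).
Proof.
case: (eqVneq (2 * t - 1) 0) => [->|]; last by move=> /eqP; right.
by left; rewrite /= normr0 mulr0 h0; exact: (set_val_mem d).
Qed.

Let lift (p : set_type D * I * R) : set_type W :=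
  SigSub (mem_set (lift_subproof p.1.1 (set_val p.1.2) p.2)).

Let liftE p : set_val (lift p) =
  (h (set_val p.1.1, p.2 * `|2 * set_val p.1.2 - 1|), 2 * set_val p.1.2 - 1).
Proof. by []. Qed.

Let continuous_height : continuous (fun p : set_type D * I * R => 2 * set_val p.1.2 - 1).
Proof.
apply: continuous_subr; last exact: cst_continuous.
apply: continuous_mulr; first exact: cst_continuous.
apply: (continuous_compose (f := fun p : set_type D * I * R => p.1.2));
  last exact: continuous_set_val.
exact: continuous_compose (@continuous_fst _ _) (@continuous_snd _ _).
Qed.

Let continuous_lift : continuous lift.
Proof.
apply: continuous_set_type; apply: continuous_pairing; last exact: continuous_height.
apply: continuous_compose continuous_h; apply: continuous_pairing.
  apply: (continuous_compose (f := fun p : set_type D * I * R => p.1.1));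
  last exact: continuous_set_val.
  exact: continuous_compose (@continuous_fst _ _) (@continuous_fst _ _).
by apply: continuous_mulr; [exact: continuous_snd|exact: continuous_normr].
Qed.

(** At either end the contraction time is 1, where [h] has forgotten its argument. *)
Let of_susp_ext (d d' : set_type D) (t : I) :
  set_val t = 0 \/ set_val t = 1 -> lift ((d, t), 1) = lift ((d', t), 1).
Proof.
move=> t01; apply: set_val_injective.
have e : 1 * `|2 * set_val t - 1| = 1.
  by rewrite mul1r; case: t01 => ->; rewrite ?mulr0 ?sub0r ?normrN ?normr1// mulr1
    (_ : 2 - 1 = 1) ?normr1//; lra.
rewrite -[LHS]/(h (set_val d, 1 * `|2 * set_val t - 1|), 2 * set_val t - 1).
rewrite -[RHS]/(h (set_val d', 1 * `|2 * set_val t - 1|), 2 * set_val t - 1).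
by rewrite e !h1.
Qed.

(** At the ends the second coordinate is 1 or -1, and [phi] is at most 1, so the value is a pole
    whatever [s] is. *)
Let to_susp_lift_ext (d d' : set_type D) (t : I) (s : R) :
  set_val t = 0 \/ set_val t = 1 ->
  to_susp (lift ((d, t), s)) = to_susp (lift ((d', t), s)).
Proof.
move=> [] t01.
- have bot d'' : to_susp (lift ((d'', t), s)) = \pi_SD (d0, clamp 0).
    by apply: to_susp_bot; rewrite /= t01; [|apply: (le_trans (phi_le1 _))]; lra.
  by rewrite !bot.
- have top d'' : to_susp (lift ((d'', t), s)) = \pi_SD (d0, clamp 1).
    by apply: to_susp_top; rewrite /= t01; [|apply: (le_trans (phi_le1 _))]; lra.
  by rewrite !top.
Qed.

Let to_susp_lift0 (a : set_type D * I) :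
  to_susp (lift (a, 0)) = \pi_SD (a.1, clamp ((1 + u (set_val (lift (a, 0)))) / 2)).
Proof. by rewrite /to_susp [in toD _]liftE mul0r h0 toDK. Qed.

(** The height moves linearly between [u] and the second coordinate. These vanish together, with
    contraction time 0, and otherwise share their sign, so no intermediate height is 0. *)
Let shrink_subproof (w : set_type W) (r : I) :
  W (h ((set_val w).1, (1 - set_val r) * `|u (set_val w)|),
     (1 - set_val r) * u (set_val w) + set_val r * (set_val w).2).
Proof.
have := unit_interval_le1 r; have := unit_interval_ge0 r; move: (set_val r) => s s0 s1.
have Ww := set_val_mem w.
case: (eqVneq (set_val w).2 0) => [w2|w2].
  left; rewrite /u w2 mulr0 mul0r normr0 mulr0 /= h0.
  by case: Ww => // /(_ w2).
right; rewrite [X in X <> _]/=; have := u_ge0 Ww; have := u_eq0 Ww.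
move: (u _) (set_val w).2 w2 => x y y0 x0 xy e.
have xn0 : x != 0 by apply/eqP => /x0 /eqP; rewrite (negbTE y0).
have [x_ge0|x_lt0] := leP 0 x.
- have y_gt0 : 0 < y by rewrite lt0r y0 -xy.
  have x_gt0 : 0 < x by rewrite lt0r xn0.
  have := mulr_ge0 s0 (ltW y_gt0).
  have : 0 <= (1 - s) * x by rewrite mulr_ge0// subr_ge0.
  (* Terms of the same sign with sum zero both vanish, which would force [s = 0] and [1 - s = 0] at
     once. *)
  move=> p q; have /eqP : (1 - s) * x = 0 by lra.
  have /eqP : s * y = 0 by lra.
  rewrite !mulf_eq0 (negbTE y0) (negbTE xn0) !orbF => /eqP ->.
  by rewrite subr0 oner_eq0.
- have y_lt0 : y < 0 by rewrite ltNge -xy -ltNge.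
  have := mulr_ge0_le0 s0 (ltW y_lt0).
  have : (1 - s) * x <= 0 by rewrite mulr_ge0_le0 ?subr_ge0// ltW.
  move=> p q; have /eqP : (1 - s) * x = 0 by lra.
  have /eqP : s * y = 0 by lra.
  rewrite !mulf_eq0 (negbTE y0) (negbTE xn0) !orbF => /eqP ->.
  by rewrite subr0 oner_eq0.
Qed.

Let shrink (p : set_type W * I) : set_type W :=
  SigSub (mem_set (shrink_subproof p.1 p.2)).

Let shrinkE p : set_val (shrink p) =
  (h ((set_val p.1).1, (1 - set_val p.2) * `|u (set_val p.1)|),
   (1 - set_val p.2) * u (set_val p.1) + set_val p.2 * (set_val p.1).2).
Proof. by []. Qed.

Let continuous_shrink : continuous shrink.
Proof.
have ct : continuous (fun p : set_type W * I => set_val p.2).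
  exact: continuous_compose (@continuous_snd _ _) (@continuous_set_val _ _).
have ct' : continuous (fun p : set_type W * I => 1 - set_val p.2).
  by apply: continuous_subr; first exact: cst_continuous.
have cw : continuous (fun p : set_type W * I => set_val p.1).
  exact: continuous_compose (@continuous_fst _ _) (@continuous_set_val _ _).
have cu : continuous (fun p : set_type W * I => u (set_val p.1)).
  exact: continuous_compose (@continuous_fst _ _) continuous_u.
apply: continuous_set_type; apply: continuous_pairing.
  apply: continuous_compose continuous_h; apply: continuous_pairing.
    exact: continuous_compose cw (@continuous_fst _ _).
  by apply: continuous_mulr; last exact: continuous_normr.
apply: continuous_addr; apply: continuous_mulr => //.
exact: continuous_compose cw (@continuous_snd _ _).
Qed.

(** Off [D] the map [toD] returns the default point; there [u] is 1 or -1, and [h] at time 1 sends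
    every point to [p0]. *)
Let lift_to_susp (w : set_type W) :
  set_val (lift ((toD (set_val w).1, clamp ((1 + u (set_val w)) / 2)), 1)) =
  (h ((set_val w).1, `|u (set_val w)|), u (set_val w)).
Proof.
have Ww := set_val_mem w.
rewrite liftE /= clampK; last exact/half_bound/u_bound.
rewrite (_ : 2 * ((1 + u (set_val w)) / 2) - 1 = u (set_val w)); last by lra.
rewrite mul1r; case: (pselect (D (set_val w).1)) => [/toDE-> //|/negP nD].
have p0E : phi (set_val w).1 = 0.
  by apply/eqP; rewrite eq_le phi_ge0 andbT leNgt.
suff -> : `|u (set_val w)| = 1 by rewrite !h1.
have [w2|w2] := leP 0 (set_val w).2.
  by rewrite u_eq1 ?normr1// p0E mulr_ge0.
by rewrite u_eqN1 ?normrN ?normr1 ?ltW// p0E; lra.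
Qed.

Lemma thickening_susp :
  homotopy_equivalent R (set_type W) (suspension R (set_type D)).
Proof.
have cid : continuous (fun a : set_type D * I => a) by move=> ?; exact: cvg_id.
have [||g cg gE] := @susp_lift R (set_type D) _ (fun a => lift (a, 1)).
- apply: continuous_compose continuous_lift.
  by apply: continuous_pairing => //; exact: cst_continuous.
- by move=> d d' t; exact: of_susp_ext.
exists to_susp, g; split => //; split => //; split.
- exists shrink; split=> //; split => w t tE; apply: set_val_injective; rewrite shrinkE tE.
    by rewrite /= gE lift_to_susp subr0 !mul1r mul0r addr0.
  by rewrite subrr !mul0r add0r mul1r h0; case: (set_val w).
have ct : continuous (fun p : set_type D * I * I => set_val p.2).
  exact: continuous_compose (@continuous_snd _ _) (@continuous_set_val _ _).
have ct' : continuous (fun p : set_type D * I * I => 1 - set_val p.2).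
  by apply: continuous_subr; first exact: cst_continuous.
(* The other composite is deformed in two stages. First [G] undoes the contraction, the factor in
   [lift] going from 1 to 0. *)
have [||G cG GE] := @susp_lift_homotopy R (set_type D) _
    (fun p => to_susp (lift (p.1, 1 - set_val p.2))).
- apply: continuous_compose continuous_to_susp.
  apply: continuous_compose continuous_lift.
  by apply: continuous_pairing => //; exact: continuous_fst.
- by move=> d d' t r t01; exact: to_susp_lift_ext.
(* Then [K] moves the truncated height linearly back to the original one, keeping the point of [D]
   fixed. *)
have [||K cK KE] := @susp_lift_homotopy R (set_type D) _
    (fun p => \pi_SD (p.1.1, clamp ((1 - set_val p.2) *
      ((1 + u (set_val (lift (p.1, 0)))) / 2) + set_val p.2 * set_val p.1.2))).
- apply: continuous_compose (@continuous_susp_pi _ _).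
  apply: continuous_pairing.
    exact: continuous_compose (@continuous_fst _ _) (@continuous_fst _ _).
  apply: continuous_compose (@continuous_clamp R).
  apply: continuous_addr; apply: continuous_mulr => //.
    apply: continuous_mulr; last exact: cst_continuous.
    apply: continuous_addr; first exact: cst_continuous.
    apply: continuous_compose continuous_u.
    apply: continuous_compose continuous_lift.
    by apply: continuous_pairing; [exact: continuous_fst|exact: cst_continuous].
  apply: (continuous_compose (f := fun p : set_type D * I * I => p.1.2));
  last exact: continuous_set_val.
  exact: continuous_compose (@continuous_fst _ _) (@continuous_snd _ _).
- move=> d d' t r t01.
  (* At the ends the truncated height is already [t], so the interpolation never leaves the pole. *)
  have uE d'' : (1 + u (set_val (lift ((d'', t), 0)))) / 2 = set_val t.
    case: t01 => tE.
      rewrite u_eqN1; [|exact: set_val_mem|..]; rewrite ?liftE /= tE; first lra.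
        lra.
      by apply: (le_trans (phi_le1 _)); lra.
    rewrite u_eq1; [|exact: set_val_mem|..]; rewrite ?liftE /= tE; first lra.
      lra.
    by apply: (le_trans (phi_le1 _)); lra.
  rewrite /= !uE -mulrDl subrK mul1r set_valK; exact: susp_eqP.
apply: (@homotopic_trans _ _ _ _ (fun q => G (q, clamp 1))).
- exists G; split => //; split => q t tE.
    by rewrite -[q]reprK GE tE subr0 /= gE.
  by rewrite -(set_valK t) tE.
- exists K; split => //; split => q t tE; rewrite -[q]reprK KE tE.
    rewrite GE clampK ?ler01 ?lexx// subrr to_susp_lift0.
    by rewrite subr0 mul1r mul0r addr0.
  by rewrite subrr mul0r add0r mul1r set_valK -surjective_pairing.
Qed.

End ThickeningSuspension.

(** * Continuity in the pointwise topology and in normed modules *)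

Lemma continuous_ptws (T : topologicalType) (J : Type) (Y : topologicalType)
    (f : T -> {ptws J -> Y}) :
  (forall i, continuous (fun x => f x i)) -> continuous f.
Proof.
move=> cf x; apply/cvg_sup => i U [_ [[W oW <-] Wx] WU].
have : nbhs (f x i) W by exact: open_nbhs_nbhs.
move=> /(cf i x); apply: (@filterS _ (nbhs x)) => y; exact: WU.
Qed.

Lemma continuous_ptws_eval (J : eqType) (Y : topologicalType) (i : J) :
  continuous (fun x : {ptws J -> Y} => x i).
Proof. exact: (@proj_continuous J (fun=> Y) i). Qed.

(** The initial value [z] may vary with the point, as it does in [maxmin]. *)
Lemma continuous_bigop (R : realType) (op : R -> R -> R) (T : topologicalType)
    (J : Type) (r : seq J) (P : pred J) (z : T -> R) (f : J -> T -> R) :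
  (forall a b : T -> R, continuous a -> continuous b ->
    continuous (fun x => op (a x) (b x))) ->
  continuous z -> (forall i, continuous (f i)) ->
  continuous (fun x => \big[op/z x]_(i <- r | P i) f i x).
Proof.
move=> cop cz cf; elim: r => [|i r IH].
  by under eq_fun do rewrite big_nil.
under eq_fun do rewrite big_cons.
by case: (P i) => //; exact: cop.
Qed.

Section VectorValued.
Context (R : realType) (F : normedModType R) (T : topologicalType).
Context (a : T -> R) (f g : T -> F).
Hypotheses (ca : continuous a) (cf : continuous f) (cg : continuous g).

Lemma continuous_addv : continuous (fun x => f x + g x).
Proof. by move=> x; exact: (cvgD (@cf x) (@cg x)). Qed.

Lemma continuous_subv : continuous (fun x => f x - g x).
Proof. by move=> x; exact: (cvgB (@cf x) (@cg x)). Qed.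

Lemma continuous_scalev : continuous (fun x => a x *: f x).
Proof. by move=> x; exact: (cvgZ (@ca x) (@cf x)). Qed.

Lemma continuous_normv : continuous (fun x => `|f x|).
Proof. by move=> x; exact: (cvg_norm (@cf x)). Qed.

End VectorValued.

(** * A continuous function whose positivity set is the diagonal complement *)

Section Gap.
Context (R : realType) (F : normedModType R) (m : nat) (K : {set {set 'I_m}}).
Local Notation V := {ptws 'I_m -> F}.

(** Each double sum vanishes exactly when [x] is constant on [I]. Starting the minimum at 1 gives
    the upper bound that [thickening_susp] asks for. *)
Definition diag_gap (x : V) : R :=
  \big[Num.min/1]_(I : {set 'I_m} | I \notin K)
    \sum_(i in I) \sum_(j in I) `|x i - x j|.

Lemma continuous_diag_gap : continuous diag_gap.
Proof.
apply: continuous_bigop; [exact: continuous_minr|exact: cst_continuous|move=> I].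
do 2![apply: continuous_bigop; [exact: continuous_addr|exact: cst_continuous|move=> ?]].
by apply: continuous_normv; apply: continuous_subv; exact: continuous_ptws_eval.
Qed.

Let sum_ge0 (I : {set 'I_m}) (x : V) :
  0 <= \sum_(i in I) \sum_(j in I) `|x i - x j|.
Proof. by rewrite sumr_ge0// => i _; rewrite sumr_ge0. Qed.

Lemma diag_gap_ge0 x : 0 <= diag_gap x.
Proof. by rewrite /diag_gap; apply/bigmin_geP; split. Qed.

Lemma diag_gap_le1 x : diag_gap x <= 1.
Proof. exact: bigmin_le_id. Qed.

Lemma diag_gap_gt0P x : 0 < diag_gap x <-> diag_compl K x.
Proof.
split=> [/bigmin_gtP[_ H] I IK|H].
  apply: contrapT => nH; have := H I IK; apply/negP; rewrite -leNgt.
  rewrite big1// => i iI; rewrite big1// => j jI.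
  rewrite (_ : x i = x j) ?subrr ?normr0//.
  by apply: contrapT => xij; apply: nH; exists i, j.
apply/bigmin_gtP; split => // I /H[i [j [iI jI xij]]].
rewrite (bigD1 i)//= (bigD1 j)//= -addrA ltr_pwDl//.
  by rewrite normr_gt0 subr_eq0; apply/eqP.
by rewrite addr_ge0// ?sumr_ge0// => k _; rewrite sumr_ge0.
Qed.

Lemma diag_compl_translate (x : V) (a : F) :
  diag_compl K (fun i => x i + a) <-> diag_compl K x.
Proof.
by split => H I /H[i [j [iI jI xij]]]; exists i, j; split => //;
  [move=> e; apply: xij; rewrite e|move=> /addIr].
Qed.

Lemma diag_complN (x : V) : ~ diag_compl K x ->
  exists2 I : {set 'I_m}, I \notin K & forall i j, i \in I -> j \in I -> x i = x j.
Proof.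
move=> H; apply: contrapT => nH; apply: H => I IK.
apply: contrapT => nI; apply: nH; exists I => // i j iI jI.
by apply: contrapT => xij; apply: nI; exists i, j.
Qed.

(** A nonface has at least two elements, and the multiples of [e] are pairwise distinct. This
    supplies a point of the diagonal complement. *)
Lemma diag_compl_injective (e : F) : e != 0 -> is_simplicial_complex K ->
  no_ghost_vertices K -> diag_compl K (fun i : 'I_m => (i%:R : R) *: e).
Proof.
move=> e0 [K0 _] K1 I IK.
have /card_gt1P[i [j [iI jI ij]]] : (1 < #|I|)%N.
  rewrite ltnNge; apply: contra IK; rewrite leq_eqVlt ltnS leqn0 cards_eq0.
  by move=> /orP[/cards1P[i ->]|/eqP->].
exists i, j; split => //; apply/eqP; rewrite -subr_eq0 -scalerBl scaler_eq0.
by rewrite (negbTE e0) orbF subr_eq0 eqr_nat.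
Qed.

End Gap.

(** * From the coordinate complement to pairs over the diagonal complement *)

Section CoordinateComplement.
Context (R : realType) (F : normedModType R) (m : nat) (K : {set {set 'I_m}}).
Local Notation V := {ptws 'I_m -> F}.
Context (s : V -> F).
Hypothesis continuous_s : continuous s.
Hypothesis s_const : forall (I : {set 'I_m}) (x : V) (c : F), I \notin K ->
  (forall i, i \in I -> x i = c) -> s x = c.

Let constN (x : V) : ~ diag_compl K x ->
  exists2 I : {set 'I_m}, I \notin K & forall i, i \in I -> x i = s x.
Proof.
move=> /diag_complN[I IK xI]; exists I => // i iI.
by rewrite (@s_const I x (x i))// => j jI; exact: xI.
Qed.

(** The inverse of [x] to [(x, s x)] translates [v] by [c - s v]. One composite is the identity on
    the nose; for the other, the translation is faded out. *)
Lemma coord_compl_thickening : homotopy_equivalent R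
  (set_type (coord_compl (0 : F) K))
  (set_type [set w : V * F | 0 < diag_gap K w.1 \/ w.2 <> 0]).
Proof.
pose g (w : V * F) : V := fun i => w.1 i + (w.2 - s w.1).
pose H (p : V * R) : V := p.1.
(* Time 0 is the composite and time 1 the identity. Outside the diagonal complement [sg] makes the
   second coordinate constant, so it stays nonzero. *)
pose G (p : V * F * R) : V * F :=
  (fun i => p.1.1 i + (1 - p.2) *: (p.1.2 - s p.1.1),
   p.2 *: p.1.2 + (1 - p.2) *: s (g p.1)).
have c1 : continuous (fun p : V * F * R => p.1.1).
  exact: continuous_compose (@continuous_fst _ _) (@continuous_fst _ _).
have c2 : continuous (fun p : V * F * R => p.1.2).
  exact: continuous_compose (@continuous_fst _ _) (@continuous_snd _ _).
have c3 : continuous (fun p : V * F * R => 1 - p.2).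
  by apply: continuous_subr; [exact: cst_continuous|exact: continuous_snd].
have cg : continuous g.
  apply: continuous_ptws => i; apply: continuous_addv.
    exact: continuous_compose (@continuous_fst _ _) (@continuous_ptws_eval _ _ i).
  apply: continuous_subv; first exact: continuous_snd.
  exact: continuous_compose (@continuous_fst _ _) continuous_s.
(* If [v] is constant on a nonface, the translation changes the constant from [s v] to [c]. *)
have sg v c : ~ diag_compl K v -> s (g (v, c)) = c.
  move=> /constN[I IK vI]; apply: (s_const IK) => i /vI.
  by rewrite /g /= => ->; rewrite addrC subrK.
apply: (@homotopy_equivalent_subsets R _ _ _ _ (fun x => (x, s x)) g H G).
- by apply: continuous_pairing => // x; exact: cvg_id.
- exact: cg.
- exact: continuous_fst.
- apply: continuous_pairing.
    apply: continuous_ptws => i; apply: continuous_addv.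
      exact: continuous_compose c1 (@continuous_ptws_eval _ _ i).
    apply: continuous_scalev => //; apply: continuous_subv => //.
    exact: continuous_compose c1 continuous_s.
  apply: continuous_addv; apply: continuous_scalev => //.
    exact: continuous_snd.
  exact: continuous_compose (continuous_compose (@continuous_fst _ _) cg) continuous_s.
- move=> x Ux; case: (pselect (diag_compl K x)) => [/diag_gap_gt0P|/constN[I IK xI]];
    first by left.
  by right => /= sx0; have [i [/xI]] := Ux I IK; rewrite sx0.
(* If the translate vanished on [I], then [v] would equal [s v - c] there. This excludes the
   diagonal complement, and [s_const] gives [s v = s v - c], hence [c = 0]. *)
- move=> [v c] /= Bvc I IK; apply: contrapT => nI.
  have vI i : i \in I -> v i = s v - c.
    move=> iI; apply: contrapT => vi; apply: nI; exists i; split => //.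
    by rewrite /g /=; apply: contra_not vi => /eqP; rewrite addr_eq0 opprB => /eqP.
  case: Bvc => [/diag_gap_gt0P/(_ I IK)[i [j [/vI -> /vI ->]]]//|].
  by apply; have /eqP := s_const IK vI; rewrite -subr_eq0 opprB addrC subrK => /eqP.
- by [].
- move=> [v c] t t01 /=; case: (pselect (diag_compl K v)) => [Dv _|].
    by left; apply/diag_gap_gt0P/diag_compl_translate.
  move=> nD [/diag_gap_gt0P//|c0]; right.
  by rewrite sg// -scalerDl addrC subrK scale1r.
- by move=> x; apply/funext => i; rewrite /g /= subrr addr0.
- by [].
- by move=> [v c]; rewrite /G /= scale0r add0r subr0 !scale1r.
- move=> [v c]; rewrite /G /= subrr !scale0r addr0 scale1r; congr (_, _).
  by apply/funext => i; rewrite addr0.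
Qed.

End CoordinateComplement.

(** * A continuous selection of the constant value on a nonface *)

Section MaxMin.
Context (R : realType) (m : nat) (K : {set {set 'I_m}}).
Local Notation V := {ptws 'I_m -> R}.

Let total (x : V) : R := \sum_(i < m) `|x i|.

(* The bounds [- total x] and [total x] only serve as neutral elements. *)
Definition maxmin (x : V) : R :=
  \big[Num.max/- total x]_(I : {set 'I_m} | I \notin K)
    \big[Num.min/total x]_(i in I) x i.

Let total_ge (x : V) i : `|x i| <= total x.
Proof. by rewrite /total (bigD1 i)//= lerDl sumr_ge0. Qed.

Lemma continuous_maxmin : continuous maxmin.
Proof.
have ct : continuous total.
  apply: continuous_bigop; [exact: continuous_addr|exact: cst_continuous|].
  by move=> i; apply: continuous_normr; exact: continuous_ptws_eval.
apply: continuous_bigop; first exact: continuous_maxr.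
  by move=> x; exact: (cvgN (ct x)).
move=> I; apply: continuous_bigop => //; first exact: continuous_minr.
exact: continuous_ptws_eval.
Qed.

(** Every nonface meets [J], so its minimum is at most [c], while [J] itself attains [c]. *)
Lemma maxmin_const (J : {set 'I_m}) (x : V) (c : R) :
  (forall I, I \notin K -> exists i, i \in I /\ i \in J) -> J \notin K ->
  (forall i, i \in J -> x i = c) -> maxmin x = c.
Proof.
(* [J] meets itself, hence is nonempty, which places [c] between the two neutral elements. *)
move=> meet JK xJ; have [j [jJ _]] := meet J JK.
have := total_ge x j; rewrite (xJ j jJ) ler_norml => /andP[lec gec].
apply/eqP; rewrite eq_le; apply/andP; split.
  apply/bigmax_leP; split => // I /meet[i [iI /xJ <-]].
  exact: bigmin_le_cond.
apply/bigmax_geP; right; exists J => //.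
by apply/bigmin_geP; split => // i /xJ ->.
Qed.

End MaxMin.

(** * Nonfaces intersect because the minimal ones do *)

Section Nonfaces.
Context (m : nat) (K : {set {set 'I_m}}).

Lemma nonface_missing_face (I : {set 'I_m}) : I \notin K ->
  exists2 J : {set 'I_m}, missing_face K J & J \subset I.
Proof.
move=> IK; have [J /minsetP[JK Jmin] JI] := @minset_exists _ (fun J => J \notin K) I IK.
exists J => //; split => // L LJ; apply: contraT => LK.
by have := Jmin L LK (proper_sub LJ) => LE; rewrite LE fintype.properxx in LJ.
Qed.

Hypothesis meet : forall I J : {set 'I_m}, missing_face K I ->
  missing_face K J -> exists i : 'I_m, i \in I /\ i \in J.

Lemma nonfaces_meet (I J : {set 'I_m}) : I \notin K -> J \notin K ->
  exists i : 'I_m, i \in I /\ i \in J.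
Proof.
move=> /nonface_missing_face[I' mI' /fintype.subsetP I'I].
move=> /nonface_missing_face[J' mJ' /fintype.subsetP J'J].
by have [i [/I'I iI /J'J iJ]] := meet mI' mJ'; exists i.
Qed.

End Nonfaces.

(** * Thickenings of the diagonal complement as suspensions *)

Section Thickenings.
Context (R : realType).

(** The contraction is scaling to the origin, and [e] provides the base point. *)
Lemma gap_thickening_susp (F : normedModType R) (m : nat) (K : {set {set 'I_m}})
    (e : F) : e != 0 -> is_simplicial_complex K -> no_ghost_vertices K ->
  homotopy_equivalent R (set_type (thickening (@diag_gap R F m K)))
    (suspension R (set_type (@diag_compl F m K))).
Proof.
move=> e0 K0 K1.
have -> : @diag_compl F m K = [set v | 0 < diag_gap K v].
  by apply/seteqP; split => x /diag_gap_gt0P.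
apply: (@thickening_susp R _ (@diag_gap R F m K)
  (fun p : {ptws 'I_m -> F} * R => (fun i => (1 - p.2) *: p.1 i) : {ptws 'I_m -> F})
  (fun=> 0) (fun i : 'I_m => (i%:R : R) *: e)).
- exact: continuous_diag_gap.
- exact: diag_gap_ge0.
- exact: diag_gap_le1.
- exact/diag_gap_gt0P/diag_compl_injective.
- apply: continuous_ptws => i; apply: continuous_scalev.
    by apply: continuous_subr; [exact: cst_continuous|exact: continuous_snd].
  exact: continuous_compose (@continuous_fst _ _) (@continuous_ptws_eval _ _ i).
- by move=> v; apply/funext => i /=; rewrite subr0 scale1r.
- by move=> v; apply/funext => i /=; rewrite subrr scale0r.
Qed.

(** The first thickening is itself open in a contractible space, so it can be thickened again; the
    pair of reals splits into two successive heights. *)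
Lemma gap_thickening2_susp (F : normedModType R) (m : nat)
    (K : {set {set 'I_m}}) :
  homotopy_equivalent R
    (set_type [set w : {ptws 'I_m -> F} * (R * R) | 0 < diag_gap K w.1 \/ w.2 <> 0])
    (suspension R (set_type (thickening (@diag_gap R F m K)))).
Proof.
pose V := {ptws 'I_m -> F}.
(* The sum is positive exactly on the thickening; the minimum with 1 keeps it bounded. *)
pose phi (w : V * R) : R := Num.min 1 (diag_gap K w.1 + `|w.2|).
have phiP w : 0 < phi w <-> thickening (@diag_gap R F m K) w.
  rewrite /phi lt_min ltr01 /=; have := diag_gap_ge0 K w.1.
  rewrite /thickening /= le0r => /orP[/eqP->|g0].
    by rewrite add0r normr_gt0 ltxx; split => [/eqP|[//|/eqP]]; [right|].
  by split => _; [left|rewrite ltr_wpDr].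
have -> : thickening (@diag_gap R F m K) = [set w | 0 < phi w].
  by apply/seteqP; split => w /phiP.
apply: (@homotopy_equivalent_trans R _ (set_type (thickening phi))).
  have ca : continuous (fun w : V * (R * R) => ((w.1, w.2.1), w.2.2)).
    apply: continuous_pairing; first apply: continuous_pairing.
    - exact: continuous_fst.
    - exact: continuous_compose (@continuous_snd _ _) (@continuous_fst _ _).
    - exact: continuous_compose (@continuous_snd _ _) (@continuous_snd _ _).
  have cb : continuous (fun w : V * R * R => (w.1.1, (w.1.2, w.2))).
    apply: continuous_pairing; last apply: continuous_pairing.
    - exact: continuous_compose (@continuous_fst _ _) (@continuous_fst _ _).
    - exact: continuous_compose (@continuous_fst _ _) (@continuous_snd _ _).
    - exact: continuous_snd.
  (* The maps only regroup coordinates and are mutually inverse, so constant homotopies suffice. *)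
  apply: (@homotopy_equivalent_subsets R _ _ _ _
    (fun w : V * (R * R) => ((w.1, w.2.1), w.2.2))
    (fun w : V * R * R => (w.1.1, (w.1.2, w.2))) fst fst) => //.
  - exact: continuous_fst.
  - exact: continuous_fst.
  - move=> [v [a b]] /= [g0|ab]; first by left; apply/phiP; left.
    have [b0|/eqP b0] := eqVneq b 0; last by right.
    by left; apply/phiP; right => /= a0; apply: ab; rewrite a0 b0.
  - move=> [[v a] b] /= [/phiP[g0|a0]|b0]; first by left.
      by right => -[].
    by right => -[].
  - by move=> [v [a b]].
  - by move=> [[v a] b].
(* The base point has height 1, which puts it in the thickening whatever its vector part is. *)
apply: (@thickening_susp R _ phi
  (fun p : V * R * R => ((fun i => (1 - p.2) *: p.1.1 i) : V, (1 - p.2) * p.1.2))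
  (fun=> 0, 0) (fun=> 0, 1)).
- apply: continuous_minr; first exact: cst_continuous.
  apply: continuous_addr; last exact: continuous_normr (@continuous_snd _ _).
  exact: continuous_compose (@continuous_fst _ _) (@continuous_diag_gap _ _ _ _).
- by move=> w; rewrite /phi le_min ler01 addr_ge0// diag_gap_ge0.
- by move=> w; rewrite /phi ge_min lexx.
- by apply/phiP; right => /eqP; rewrite oner_eq0.
- have cr : continuous (fun p : V * R * R => 1 - p.2).
    by apply: continuous_subr; [exact: cst_continuous|exact: continuous_snd].
  apply: continuous_pairing.
    apply: continuous_ptws => i; apply: continuous_scalev => //.
    apply: (continuous_compose (f := fun p : V * R * R => p.1.1)
      (g := fun x : V => x i)); last exact: continuous_ptws_eval.
    exact: continuous_compose (@continuous_fst _ _) (@continuous_fst _ _).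
  apply: continuous_mulr => //.
  exact: continuous_compose (@continuous_fst _ _) (@continuous_snd _ _).
- move=> [v a] /=; rewrite subr0 mul1r; congr (_, _).
  by apply/funext => i; rewrite scale1r.
- move=> [v a] /=; rewrite subrr mul0r; congr (_, _).
  by apply/funext => i; rewrite scale0r.
Qed.

End Thickenings.

Theorem theorem4p6 (R : realType) (m : nat) (K : {set {set 'I_m}}) :
  is_simplicial_complex K ->
  no_ghost_vertices K ->
  (forall I J : {set 'I_m}, missing_face K I -> missing_face K J ->
     exists i : 'I_m, i \in I /\ i \in J) ->
  homotopy_equivalent R (U_C R K) (suspension R (suspension R (D_C R K))) /\
  homotopy_equivalent R (U_R R K) (suspension R (D_R R K)).
Proof.
move=> K0 K1 /nonfaces_meet meet; split.
(* Writing the plane as [R^o * R^o] makes it a normed module over [R], with the same product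
   topology. *)
- pose C := (R^o * R^o)%type.
  pose s (x : {ptws 'I_m -> C}) : C :=
    (maxmin K (fun i => (x i).1), maxmin K (fun i => (x i).2)).
  have e0 : ((1, 0) : C) != 0 by rewrite xpair_eqE oner_eq0.
  have cs : continuous s.
    apply: continuous_pairing.
      apply: (continuous_compose (g := @maxmin R m K)); last exact: continuous_maxmin.
      apply: continuous_ptws => i.
      exact: continuous_compose (@continuous_ptws_eval _ _ i) (@continuous_fst _ _).
    apply: (continuous_compose (g := @maxmin R m K)); last exact: continuous_maxmin.
    apply: continuous_ptws => i.
    exact: continuous_compose (@continuous_ptws_eval _ _ i) (@continuous_snd _ _).
  have s_const (I : {set 'I_m}) (x : {ptws 'I_m -> C}) (c : C) :
      I \notin K -> (forall i, i \in I -> x i = c) -> s x = c.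
    move=> IK xI; rewrite /s; case: c xI => a b xI; congr (_, _).
      by apply: (@maxmin_const R m K I) => // [J JK|i /xI ->//]; exact: meet.
    by apply: (@maxmin_const R m K I) => // [J JK|i /xI ->//]; exact: meet.
  (* [h1] passes to pairs with a complex second coordinate, [h2] turns one real height into the
     outer suspension, and [h3] suspends the equivalence for the other height. *)
  have h1 := @coord_compl_thickening R C m K s cs s_const.
  have h2 := @gap_thickening2_susp R C m K.
  have h3 := homotopy_equivalent_susp (gap_thickening_susp e0 K0 K1).
  exact: (homotopy_equivalent_trans h1 (homotopy_equivalent_trans h2 h3)).
- have h1 := @coord_compl_thickening R R^o m K (@maxmin R m K)
    (@continuous_maxmin R m K).
  have h2 := gap_thickening_susp (oner_neq0 R : 1 != 0 :> R^o) K0 K1.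
  apply: (homotopy_equivalent_trans (h1 _) h2) => I x c IK xI.
  by apply: (@maxmin_const R m K I) => // J JK; exact: meet.
Qed.
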